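(* Let $(M,\Phi,E_+,E_-)$ be a strong generalized contact structure on a smooth odd-dimensional manifold $M$, and let $\pi_M=\pi_0+e_+\wedge e_-$ be the bivector field associated to it, where $e_\pm=pr_{TM}E_\pm$ and $\pi_0$ is the bivector underlying $\Phi$. If $[[E_+,E_-]]=0$, then $\pi_M$ is a Poisson structure on $M$, i.e. the Schouten bracket satisfies $[\pi_M,\pi_M]=0$.
   Context: On $TM\oplus T^*M$ use the neutral metric $\langle X+\alpha,Y+\beta\rangle=\frac12(\beta(X)+\alpha(Y))$ and the Courant bracket $[[X+\alpha,Y+\beta]]=[X,Y]+\mathcal L_X\beta-\mathcal L_Y\alpha-\frac12 d(\iota_X\beta-\iota_Y\alpha)$. Adjoints are taken with respect to $\langle\cdot,\cdot\rangle$, and for sections $E,F$ of $TM\oplus T^*M$ we put $(E\otimes F)(u)=2\langle F,u\rangle E$. A generalized almost contact structure on $M$ is a triple $(\Phi,E_\pm)$ with $\Phi$ an endomorphism of $TM\oplus T^*M$ and $E_\pm$ sections of $TM\oplus T^*M$ such that $\Phi+\Phi^*=0$, $\Phi\circ\Phi=-Id+E_+\otimes E_-+E_-\otimes E_+$, $\langle E_\pm,E_\pm\rangle=0$ and $2\langle E_+,E_-\rangle=1$. Then $\Phi$ has eigenvalues $0,\pm\sqrt{-1}$ on $(TM\oplus T^*M)\otimes\mathbb C$; $E^{(1,0)}$ and $E^{(0,1)}$ denote the $\sqrt{-1}$ and $-\sqrt{-1}$ eigenbundles, and $\ker\Phi$ is spanned by $E_+$ and $E_-$. Let $L_{E_\pm}$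 be the line bundle spanned by $E_\pm$ and $L^\pm=L_{E_\pm}\oplus E^{(1,0)}$. The structure is a generalized contact structure if $L^+$ or $L^-$ is closed under the Courant bracket, and it is strong if both are. Bivector $\pi_0$ (the paper's construction): locally, on a neighborhood $U$ of a point, $E^{(1,0)}\oplus E^{(0,1)}=(E_+\oplus E_-)^\perp\otimes\mathbb C$ is identified with $T_{\mathbb C}W\oplus T^*_{\mathbb C}W$ for a transversal $W$ to the foliation generated by $e_+,e_-$, and $\Phi$ restricts there to a generalized complex structure; $\pi_0$ is the canonical Poisson bivector of that generalized complex structure, extended to a bivector on $U\subset M$. Here the canonical Poisson bivector of a generalized complex structure $\mathcal J$ is the $T^*\to T$ component of $\mathcal J$, and since $\Phi$ vanishes on $E_\pm$, the extension of $\pi_0$ to $M$ is the $T^*M\to TM$ component of $\Phi$, $\pi_0(\alpha)=pr_{TM}(\Phi\alpha)$. *)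

(* Defs.v *)
From HB Require Import structures.
From mathcomp Require Import all_boot all_order all_algebra.
From mathcomp Require Import all_classical all_reals all_analysis.
From mathcomp Require Import ring.
Set Implicit Arguments.
Unset Strict Implicit.
Unset Printing Implicit Defensive.
Import Order.TTheory GRing.Theory Num.Theory.
Import numFieldNormedType.Exports.
Local Open Scope classical_set_scope.
Local Open Scope ring_scope.

Section ContinuouslyDifferentiable.
Variables (R : realType) (n : nat).
Implicit Types (U : set 'rV[R]_n) (f g : 'rV[R]_n -> R).

Fixpoint Ck (k : nat) U f : Prop :=
  (forall x, U x -> {for x, continuous f}) /\
  (if k is k'.+1 then
     forall i : 'I_n, let e := delta_mx ord0 i in
       (forall x, U x -> derivable f x e) /\ Ck k' U ('D_e f)
   else True).

Definition Coo U f : Prop := forall k, Ck k U f.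

Lemma Ck_continuous k U f x : Ck k U f -> U x -> {for x, continuous f}.
Proof. by case: k => [|k] [cf _]; apply: cf. Qed.

Lemma Ck_pred k U f : Ck k.+1 U f -> Ck k U f.
Proof.
elim: k f => [|k IH] f [cf df]; first by split.
by split=> // i; have [dfi /IH] := df i.
Qed.

Lemma Ck_ext k U f g : open U -> {in U, f =1 g} -> Ck k U f -> Ck k U g.
Proof.
move=> oU; have nearU h h' x : {in U, h =1 h'} -> U x ->
    \forall y \near nbhs x, h y = h' y.
  by move=> hh Ux; apply: filterS (open_nbhs_nbhs (conj oU Ux)) => y Uy;
     apply/hh/mem_set.
have contU (h h' : 'rV[R]_n -> R) : {in U, h =1 h'} ->
    (forall x, U x -> {for x, continuous h}) ->
    forall x, U x -> {for x, continuous h'}.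
  move=> hh ch x Ux; rewrite /prop_for /continuous_at -(hh x (mem_set Ux)).
  apply: cvg_trans (ch x Ux).
  by apply: (@near_eq_cvg _ _ (nbhs x)); exact: nearU hh Ux.
elim: k f g => [|k IH] f g fg [cf df].
  by split=> //; exact: contU fg cf.
split=> [|i /=]; first exact: contU fg cf.
have [dfi Dfi] := df i.
split=> [x Ux|].
  exact: (near_eq_derivable (nearU _ _ _ _ fg Ux) (dfi x Ux)).
apply: IH Dfi => x /set_mem Ux.
exact: near_eq_derive (nearU _ _ _ _ fg Ux).
Qed.

Lemma Ck_cst k U (a : R) : Ck k U (cst a).
Proof.
elim: k a => [|k IH] a; (split; first by move=> x _; exact: cst_continuous) => // i.
split=> [x _|]; first exact: derivable_cst.
rewrite (_ : 'D_ _ _ = cst 0) //; apply/funext => x; exact: derive_cst.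
Qed.

Lemma CkD k U f g : open U -> Ck k U f -> Ck k U g -> Ck k U (f + g).
Proof.
move=> oU; elim: k f g => [|k IH] f g Cf Cg;
  (split; first by move=> x Ux; apply: continuousD;
    [exact: Ck_continuous Cf Ux | exact: Ck_continuous Cg Ux]) => // i.
have [dfi Dfi] := Cf.2 i; have [dgi Dgi] := Cg.2 i.
split=> [x Ux|]; first by apply: derivableD; [exact: dfi | exact: dgi].
apply: Ck_ext (IH _ _ Dfi Dgi) => // x /set_mem Ux.
by rewrite deriveD; [|exact: dfi|exact: dgi].
Qed.

Lemma CkM k U f g : open U -> Ck k U f -> Ck k U g -> Ck k U (f * g).
Proof.
move=> oU; elim: k f g => [|k IH] f g Cf Cg;
  (split; first by move=> x Ux; apply: continuousM;
    [exact: Ck_continuous Cf Ux | exact: Ck_continuous Cg Ux]) => // i.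
have [dfi Dfi] := Cf.2 i; have [dgi Dgi] := Cg.2 i.
split=> [x Ux|]; first by apply: derivableM; [exact: dfi | exact: dgi].
apply: Ck_ext (CkD oU (IH _ _ (Ck_pred Cf) Dgi) (IH _ _ (Ck_pred Cg) Dfi)) => //.
move=> x /set_mem Ux.
by rewrite deriveM; [|exact: dfi|exact: dgi].
Qed.

End ContinuouslyDifferentiable.

(* Only the values of chart_map on chart_dom, and of chart_inv on its image,
   are meaningful. *)
Record chart (R : realType) (n : nat) (M : topologicalType) := Chart {
  chart_dom : set M;
  chart_map : M -> 'rV[R]_n;
  chart_inv : 'rV[R]_n -> M;
  chart_open : open chart_dom;
  chart_img_open : open (chart_map @` chart_dom);
  chart_mapK : {in chart_dom, cancel chart_map chart_inv};
  chart_map_continuous :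
    forall x, chart_dom x -> {for x, continuous chart_map};
  chart_inv_continuous :
    forall y, (chart_map @` chart_dom) y -> {for y, continuous chart_inv}
}.

Record smooth_manifold (R : realType) (n : nat) := SmoothManifold {
  carrier :> topologicalType;
  manifold_hausdorff : hausdorff_space carrier;
  manifold_second_countable : @second_countable carrier;
  atlas : set (chart R n carrier);
  atlas_cover : forall x, exists2 c, atlas c & chart_dom c x;
  atlas_compatible : forall c d, atlas c -> atlas d -> forall j : 'I_n,
    Coo (chart_map c @` (chart_dom c `&` chart_dom d))
        (fun y => chart_map d (chart_inv c y) ord0 j)
}.

Section SmoothFunctions.
Variables (R : realType) (n : nat) (M : smooth_manifold R n).

Definition is_smooth (f : M -> R) : Prop :=
  forall c, atlas c -> Coo (chart_map c @` chart_dom c) (f \o chart_inv c).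

Definition smooth_pred : {pred M -> R} := [pred f | `[< is_smooth f >]].

Lemma smooth_subring_closed : subring_closed smooth_pred.
Proof.
split=> [|f g /asboolP sf /asboolP sg|f g /asboolP sf /asboolP sg];
  apply/asboolP => c ac k.
- exact: (Ck_cst k _ 1).
- have oU := @chart_img_open _ _ _ c.
  have Cg := CkM oU (Ck_cst k _ (- 1)) (sg c ac k).
  apply: Ck_ext (CkD oU (sf c ac k) Cg) => // y _ /=.
  rewrite -[LHS]/(f (chart_inv c y) + (- 1 * g (chart_inv c y))).
  by rewrite mulN1r.
- exact: CkM (@chart_img_open _ _ _ c) (sf c ac k) (sg c ac k).
Qed.

HB.instance Definition _ :=
  GRing.isSubringClosed.Build (M -> R) smooth_pred smooth_subring_closed.

Record smoothfun := SmoothFun {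
  smoothfun_val :> M -> R;
  smoothfunP : smoothfun_val \in smooth_pred
}.

HB.instance Definition _ := [isSub for smoothfun_val].
HB.instance Definition _ := [Choice of smoothfun by <:].
HB.instance Definition _ := 
  GRing.SubChoice_isSubComPzRing.Build (M -> R) _ smoothfun smooth_subring_closed.

Lemma smooth_cst (a : R) : cst a \in smooth_pred.
Proof. by apply/asboolP => c _ k; exact: (Ck_cst k _ a). Qed.

Definition scst (a : R) : smoothfun := SmoothFun (smooth_cst a).

End SmoothFunctions.

(* Sections of bundles are used instead of the bundles themselves, through the
   standard identifications: a vector field is a derivation of the R-algebra
   C^oo(M), a 1-form is a C^oo(M)-linear form on vector fields, and more
   generally a bundle map is a C^oo(M)-linear map between sections. *)
Section VectorFields.
Variables (R : realType) (n : nat) (M : smooth_manifold R n).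
Local Notation C := (smoothfun M).

Definition is_derivation (X : C -> C^o) : Prop :=
  [/\ forall f g, X (f + g) = X f + X g,
      forall a f, X (scst M a * f) = scst M a * X f
    & forall f g, X (f * g) = X f * g + f * X g].

Definition derivation_pred : {pred C -> C^o} :=
  [pred X | `[< is_derivation X >]].

Lemma derivation_submod_closed : submod_closed derivation_pred.
Proof.
split=> [|h X Y /asboolP[XD XZ XM] /asboolP[YD YZ YM]]; apply/asboolP.
  by split=> [f g|a f|f g] /=; rewrite ?addr0 ?mulr0 ?mul0r ?addr0.
have E f : (h *: X + Y) f = h * X f + Y f by [].
split=> [f g|a f|f g]; rewrite !E.
- by rewrite XD YD; ring.
- by rewrite XZ YZ; ring.
- by rewrite XM YM; ring.
Qed.

HB.instance Definition _ :=
  GRing.isSubmodClosed.Build C (C -> C^o) derivation_pred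
    derivation_submod_closed.

Record vfield := VField {
  vfield_fun :> C -> C^o;
  vfieldP : vfield_fun \in derivation_pred
}.

HB.instance Definition _ := [isSub for vfield_fun].
HB.instance Definition _ := [Choice of vfield by <:].
HB.instance Definition _ := [SubChoice_isSubLmodule of vfield by <:].

Definition form_pred : {pred vfield -> C^o} :=
  [pred a | `[< forall (f : C) X Y, a (f *: X + Y) = f * a X + a Y >]].

Lemma form_submod_closed : submod_closed form_pred.
Proof.
split=> [|h a b /asboolP aL /asboolP bL]; apply/asboolP => f X Y.
  by rewrite /= mulr0 addr0.
have E Z : (h *: a + b) Z = h * a Z + b Z by [].
by rewrite !E aL bL; ring.
Qed.

HB.instance Definition _ :=
  GRing.isSubmodClosed.Build C (vfield -> C^o) form_pred form_submod_closed.

Record oneform := OneForm {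
  oneform_fun :> vfield -> C^o;
  oneformP : oneform_fun \in form_pred
}.

HB.instance Definition _ := [isSub for oneform_fun].
HB.instance Definition _ := [Choice of oneform by <:].
HB.instance Definition _ := [SubChoice_isSubLmodule of oneform by <:].

Lemma vfD (X : vfield) (f g : C) : X (f + g) = X f + X g.
Proof. by have /asboolP[] := vfieldP X. Qed.
Lemma vfZ (X : vfield) a (f : C) : X (scst M a * f) = scst M a * X f.
Proof. by have /asboolP[] := vfieldP X. Qed.
Lemma vfM (X : vfield) (f g : C) : X (f * g) = X f * g + f * X g.
Proof. by have /asboolP[] := vfieldP X. Qed.
Lemma vfN (X : vfield) (f : C) : X (- f) = - X f.
Proof.
have X0 : X 0 = 0 by apply: (addrI (X 0)); rewrite -vfD !addr0.
by apply: (addrI (X f)); rewrite -vfD !subrr.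
Qed.
Lemma formP (a : oneform) (f : C) X Y : a (f *: X + Y) = f * a X + a Y.
Proof. by have /asboolP := oneformP a. Qed.

Lemma formD (a : oneform) X Y : a (X + Y) = a X + a Y.
Proof. by have := formP a 1 X Y; rewrite scale1r mul1r. Qed.
Lemma form0 (a : oneform) : a 0 = 0.
Proof. by apply: (addrI (a 0)); rewrite -formD !addr0. Qed.
Lemma formZ (a : oneform) (f : C) X : a (f *: X) = f * a X.
Proof. by have := formP a f X 0; rewrite form0 !addr0. Qed.
Lemma formN (a : oneform) X : a (- X) = - a X.
Proof. by rewrite -scaleN1r formZ mulN1r. Qed.

Lemma formB (a : oneform) X Y : a (X - Y) = a X - a Y.
Proof. by rewrite formD formN. Qed.

Lemma vfDE (X Y : vfield) (f : C) : (X + Y) f = X f + Y f. Proof. by []. Qed.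
Lemma vfNE (X : vfield) (f : C) : (- X) f = - X f. Proof. by []. Qed.
Lemma vfZE (g : C) (X : vfield) (f : C) : (g *: X) f = g * X f.
Proof. by []. Qed.
Lemma formDE (a b : oneform) X : (a + b) X = a X + b X. Proof. by []. Qed.
Lemma formNE (a : oneform) X : (- a) X = - a X. Proof. by []. Qed.
Lemma formZE (f : C) (a : oneform) X : (f *: a) X = f * a X.
Proof. by []. Qed.

Lemma vfield_eq (X Y : vfield) : X =1 Y -> X = Y.
Proof. by move=> XY; apply/val_inj/funext. Qed.
Lemma oneform_eq (a b : oneform) : a =1 b -> a = b.
Proof. by move=> ab; apply/val_inj/funext. Qed.

Lemma lie_subproof (X Y : vfield) :
  (fun f => X (Y f) - Y (X f)) \in derivation_pred.
Proof.
apply/asboolP; split=> [f g|a f|f g].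
- by rewrite !vfD; ring.
- by rewrite !vfZ; ring.
- by rewrite !vfM !vfD !vfM; ring.
Qed.

Definition lie (X Y : vfield) : vfield := VField (lie_subproof X Y).

Lemma lieE X Y (f : C) : lie X Y f = X (Y f) - Y (X f). Proof. by []. Qed.

Lemma lie_linear (X Y Z : vfield) (f : C) :
  lie X (f *: Y + Z) = f *: lie X Y + ((X f : C) *: Y + lie X Z).
Proof.
apply: vfield_eq => g.
by rewrite !(vfDE, vfZE, lieE) vfD vfM; ring.
Qed.

Lemma dform_subproof (f : C) : (fun X : vfield => X f) \in form_pred.
Proof. by apply/asboolP. Qed.

Definition dform (f : C) : oneform := OneForm (dform_subproof f).

Lemma lieform_subproof (X : vfield) (b : oneform) :
  (fun Y => X (b Y) - b (lie X Y)) \in form_pred.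
Proof.
apply/asboolP => f Y Z.
rewrite lie_linear; rewrite !formD !formZ vfD vfM; ring.
Qed.

Definition lieform (X : vfield) (b : oneform) : oneform :=
  OneForm (lieform_subproof X b).

End VectorFields.

Section Bivectors.
Variables (R : realType) (n : nat) (M : smooth_manifold R n).
Local Notation C := (smoothfun M).
Local Notation X1 := (vfield M).
Local Notation O1 := (oneform M).

(* A bivector field P is represented by P# : T^*M -> TM, with
   P(a, b) = b(P# a) = - a(P# b). *)
Definition bivector_pred : {pred O1 -> X1} :=
  [pred P | `[< (forall (f : C) a b, P (f *: a + b) = f *: P a + P b) /\
                (forall a b : O1, b (P a) = - a (P b)) >]].

Lemma bivector_submod_closed : submod_closed bivector_pred.
Proof.
split=> [|h P Q /asboolP[PL PN] /asboolP[QL QN]]; apply/asboolP; split.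
- by move=> f a b /=; rewrite scaler0 addr0.
- move=> a b /=.
  by rewrite !form0 oppr0.
- move=> f a b; have E c : (h *: P + Q) c = h *: P c + Q c by [].
  rewrite !E PL QL !scalerDr !scalerA (mulrC f h) -!addrA; congr (_ + _).
  by rewrite addrCA.
- move=> a b; have E c : (h *: P + Q) c = h *: P c + Q c by [].
  by rewrite !E !formD !formZ PN QN; ring.
Qed.

HB.instance Definition _ :=
  GRing.isSubmodClosed.Build C (O1 -> X1) bivector_pred bivector_submod_closed.

Record bivector := Bivector {
  sharp :> O1 -> X1;
  bivectorP : sharp \in bivector_pred
}.

HB.instance Definition _ := [isSub for sharp].
HB.instance Definition _ := [Choice of bivector by <:].
HB.instance Definition _ := [SubChoice_isSubLmodule of bivector by <:].

Lemma wedge_subproof (X Y : X1) :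
  (fun a : O1 => (a X : C) *: Y - (a Y : C) *: X) \in bivector_pred.
Proof.
apply/asboolP; split=> [f a b|a b].
  apply: vfield_eq => g.
  by rewrite !(vfDE, vfNE, vfZE, formDE, formZE); ring.
by rewrite !(formD, formN, formZ); ring.
Qed.

(* (X /\ Y)(a, b) = a(X) b(Y) - a(Y) b(X) *)
Definition wedge (X Y : X1) : bivector := Bivector (wedge_subproof X Y).

(* The Schouten bracket of two bivector fields, evaluated on three 1-forms.
   schouten_wedge below shows that it is the biadditive extension of
   [X /\ Y, Z /\ W] = [X, Z] /\ Y /\ W - [X, W] /\ Y /\ Z
                      - [Y, Z] /\ X /\ W + [Y, W] /\ X /\ Z. *)
Definition schouten_term (P Q : bivector) (a b c : O1) : C :=
  lieform (P a) b (Q c) + lieform (Q a) b (P c).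

Definition schouten (P Q : bivector) (a b c : O1) : C :=
  schouten_term P Q a b c + schouten_term P Q b c a + schouten_term P Q c a b.

Definition poisson (P : bivector) : Prop :=
  forall a b c : O1, schouten P P a b c = 0.

Definition wedge3 (X Y Z : X1) (a b c : O1) : C :=
  a X * (b Y * c Z - b Z * c Y) - a Y * (b X * c Z - b Z * c X)
  + a Z * (b X * c Y - b Y * c X).

Lemma lieformE (X Y : X1) (b : O1) :
  lieform X b Y = X (b Y : C) - b (lie X Y).
Proof. by []. Qed.

Lemma lieform_scale (f g : C) (X Y : X1) (b : O1) :
  lieform (f *: X) b (g *: Y) =
    f * g * lieform X b Y + g * (Y f : C) * (b X : C).
Proof.
rewrite !lieformE; have -> : lie (f *: X) (g *: Y) =
    (f * g) *: lie X Y + ((f * X g) *: Y - (g * Y f) *: X).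
  by apply: vfield_eq => h; rewrite !(vfDE, vfNE, vfZE, lieE) !vfM; ring.
by rewrite formD formB !formZ vfZE vfM; ring.
Qed.

Lemma lie_anti (X Y : X1) : lie X Y = - lie Y X.
Proof. by apply: vfield_eq => h; rewrite vfNE !lieE opprB. Qed.

Lemma lieformBl (X Y Z : X1) (b : O1) :
  lieform (X - Y) b Z = lieform X b Z - lieform Y b Z.
Proof.
rewrite !lieformE; have -> : lie (X - Y) Z = lie X Z - lie Y Z.
  by apply: vfield_eq => h; rewrite !(vfDE, vfNE, lieE) !(vfD, vfN); ring.
by rewrite formB vfDE vfNE; ring.
Qed.

Lemma wedgeE (X Y : X1) (a : O1) :
  wedge X Y a = (a X : C) *: Y - (a Y : C) *: X.
Proof. by []. Qed.

Lemma lieform_wedge (X Y Z W : X1) (a b c : O1) :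
  lieform (wedge X Y a) b (wedge Z W c) =
    ((a X * c Z * lieform Y b W + c Z * W (a X : C) * b Y)
    - (a Y * c Z * lieform X b W + c Z * W (a Y : C) * b X)
    - ((a X * c W * lieform Y b Z + c W * Z (a X : C) * b Y)
    - (a Y * c W * lieform X b Z + c W * Z (a Y : C) * b X)) : C).
Proof. by rewrite !wedgeE lieformBl !formB !lieform_scale; ring. Qed.

Lemma schouten_wedge (X Y Z W : X1) (a b c : O1) :
  schouten (wedge X Y) (wedge Z W) a b c =
    wedge3 (lie X Z) Y W a b c - wedge3 (lie X W) Y Z a b c
    - wedge3 (lie Y Z) X W a b c + wedge3 (lie Y W) X Z a b c.
Proof.
rewrite /schouten /schouten_term !lieform_wedge.
rewrite !lieformE /wedge3.
rewrite (lie_anti Z X) (lie_anti W X) (lie_anti Z Y) (lie_anti W Y) !formN.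
ring.
Qed.

Lemma schouten_exact (P : bivector) (f g h : C) :
  let pb (f g : C) : C := dform g (P (dform f)) in
  schouten P P (dform f) (dform g) (dform h) =
    (pb (pb f g) h + pb (pb g h) f + pb (pb h f) g) *- 2.
Proof.
have sk (u v : C) : dform u (P (dform v)) = - dform v (P (dform u)).
  by have /asboolP[_] := bivectorP P; apply.
move=> pb; have T u v w :
    lieform (P (dform u)) (dform v) (P (dform w)) = - pb (pb u v) w.
  by rewrite lieformE /pb -sk /= subKr.
by rewrite /schouten /schouten_term !T; ring.
Qed.

End Bivectors.

(* The sections of TM (+) T^*M. *)
Notation gtangent M := (vfield M * oneform M)%type.

Section GeneralizedContact.
Variables (R : realType) (n : nat) (M : smooth_manifold R n).
Local Notation C := (smoothfun M).
Local Notation TT := (gtangent M).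
Local Notation half := (scst M 2^-1).

Definition metric (u v : TT) : C := half * (v.2 u.1 + u.2 v.1).

Lemma metric2 (u v : TT) : metric u v *+ 2 = v.2 u.1 + u.2 v.1.
Proof.
have half2 : half *+ 2 = 1.
  rewrite mulr2n; apply/val_inj/funext => x.
  by rewrite -[LHS]/(2^-1 + 2^-1 : R) -[RHS]/(1 : R); field.
by rewrite -mulrnAl half2 mul1r.
Qed.

Definition courant (u v : TT) : TT :=
  (lie u.1 v.1,
   lieform u.1 v.2 - lieform v.1 u.2
   - half *: dform (v.2 u.1 - u.2 v.1)).

Definition tensor (E F u : TT) : TT := (metric F u *+ 2) *: E.

Definition is_adjoint (A B : TT -> TT) : Prop :=
  forall u v, metric (A u) v = metric u (B v).

Record gen_almost_contact := GenAlmostContact {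
  gPhi :> {linear TT -> TT};
  gEp : TT;
  gEm : TT;
  gPhi_skew : exists2 Phis : TT -> TT,
    is_adjoint gPhi Phis & forall u, gPhi u + Phis u = 0;
  gPhi_sq : forall u,
    gPhi (gPhi u) = - u + tensor gEp gEm u + tensor gEm gEp u;
  gEp_isotropic : metric gEp gEp = 0;
  gEm_isotropic : metric gEm gEm = 0;
  gEpm_pairing : metric gEp gEm *+ 2 = 1
}.

(* A section of the complexification (TM (+) T^*M) (x) C is the pair of its
   real and imaginary parts, and so is a complex-valued smooth function. *)
Definition cscale (a : C * C) (w : TT * TT) : TT * TT :=
  (a.1 *: w.1 - a.2 *: w.2, a.1 *: w.2 + a.2 *: w.1).

Definition creal (u : TT) : TT * TT := (u, 0).

Definition phiC (Phi : TT -> TT) (w : TT * TT) : TT * TT := (Phi w.1, Phi w.2).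

Definition ccourant (w z : TT * TT) : TT * TT :=
  (courant w.1 z.1 - courant w.2 z.2, courant w.1 z.2 + courant w.2 z.1).

Definition E10 (Phi : TT -> TT) : set (TT * TT) :=
  [set w | phiC Phi w = cscale (0, 1) w].

Definition spanE10 (Phi : TT -> TT) (E : TT) : set (TT * TT) :=
  [set w | exists a, exists2 z, E10 Phi z & w = cscale a (creal E) + z].

Definition courant_closed (L : set (TT * TT)) : Prop :=
  forall w z, L w -> L z -> L (ccourant w z).

Definition Lplus (G : gen_almost_contact) := spanE10 G (gEp G).
Definition Lminus (G : gen_almost_contact) := spanE10 G (gEm G).

Definition gen_contact (G : gen_almost_contact) : Prop :=
  courant_closed (Lplus G) \/ courant_closed (Lminus G).

Definition strong_gen_contact (G : gen_almost_contact) : Prop :=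
  courant_closed (Lplus G) /\ courant_closed (Lminus G).

Lemma pi0_subproof (G : gen_almost_contact) :
  (fun a : oneform M => (G (0, a)).1) \in @bivector_pred R n M.
Proof.
apply/asboolP; split=> [f a b|a b].
  have -> : (0, f *: a + b) = f *: (0, a) + (0, b) :> TT.
    by congr pair; rewrite /= scaler0 addr0.
  by rewrite linearP.
have [Phis adj skew] := gPhi_skew G.
have PhisE u : Phis u = - G u by apply/eqP; rewrite -addr_eq0 addrC skew.
have := metric2 (G (0, a)) (0, b).
rewrite adj metric2 PhisE.
rewrite [X in X + _ = _](_ : _ = 0); last exact: form0.
rewrite [X in 0 + X = _](_ : _ = - a (G (0, b)).1); last exact: formN.
by rewrite /= form0 add0r addr0 => ->.
Qed.

(* The T^*M -> TM component of Phi. As Phi vanishes on Ep and Em, it is the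
   extension to M of the canonical Poisson bivector of the generalized complex
   structure induced by Phi on a local transversal to the foliation generated
   by the vector components of Ep and Em. *)
Definition pi0 (G : gen_almost_contact) : bivector M :=
  Bivector (pi0_subproof G).

Definition pi_M (G : gen_almost_contact) : bivector M :=
  pi0 G + wedge (gEp G).1 (gEm G).1.

End GeneralizedContact.

(* Main.v *)
Require Import Defs.
From mathcomp Require Import all_boot all_order all_algebra.
From mathcomp Require Import all_classical all_reals all_analysis.
From mathcomp Require Import ring.

(* The order matters: formD, formN, ... must denote the lemmas on 1-forms, not
   those on sesquilinear forms. *)
Import GRing.Theory Defs.
Local Open Scope ring_scope.

(** Write e+, e- for the vector components of E+, E-, and pi0 for the
    T^*M -> TM component of Phi.  By biadditivity of the Schouten bracket,
      [pi0 + e+ /\ e-, pi0 + e+ /\ e-]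
        = [pi0, pi0] + 2 [pi0, e+ /\ e-] + [e+ /\ e-, e+ /\ e-],
    and the three terms vanish separately.

    The last one does because [e+, e-] is the vector component of
    [[E+, E-]] = 0.

    For the second one it suffices that pi0 is invariant under the flows of
    e+ and e-.  Let D_u v denote the Dorfman bracket, which equals the Courant
    bracket up to d<u, v> but is a derivation in v, both of functions and of
    the metric, without correction terms.  If u is in E^(1,0), then D_(E+) u
    lies in L+, and its component along E+ is
      2 <E-, D_(E+) u> = 2 e+ <E-, u> - 2 <D_(E+) E-, u> = 0,
    so D_(E+) preserves E^(1,0).  As it also annihilates E+ and E-, it
    commutes with Phi (dorfman_Ep_Phi).  On 1-forms D_(E+) is the Lie
    derivative along e+, so the vector component of this commutation is the
    invariance of pi0; the same holds for E-.

    For the first one, E^(1,0) is the intersection of L+ and L-, hence it is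
    closed under the bracket (E10_closed).  For a 1-form a, Phi a + i p(a) is
    in E^(1,0), where p = - Phi^2 is the projection onto the orthogonal of
    E+ and E-.  Closedness for two such sections (dorfman_E10) would say at
    once, if p were the identity, that pi0 intertwines the Koszul bracket of
    1-forms with the bracket of vector fields, which gives [pi0, pi0] = 0
    (schouten_koszul).  The difference between a and p(a) is a combination of
    E+ and E-; its contributions (Phi_dorfman_proj) cancel against the bracket
    of the vector components of p(a) and p(b), because e+ and e- commute
    (pi0_koszul). *)

(** * Schouten brackets of bivector fields *)

Section BivectorCalculus.
Context {R : realType} {n : nat} {M : smooth_manifold R n}.
Local Notation C := (smoothfun M).
Local Notation X1 := (vfield M).
Local Notation O1 := (oneform M).
Implicit Types (f g h : C) (X Y Z : X1) (a b c : O1) (P Q : bivector M).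

Lemma vf1 X : X (1 : C) = 0.
Proof.
have := vfM X 1 1; rewrite !mulr1 mul1r => h.
by apply: (addrI (X 1 : C)); rewrite addr0 -h.
Qed.

Lemma vf0 X : X (0 : C) = 0.
Proof. by apply: (addrI (X (0 : C) : C)); rewrite -vfD !addr0. Qed.

Lemma lie_id X : lie X X = 0.
Proof. by apply: vfield_eq => h; rewrite lieE subrr. Qed.

Lemma lie0v X : lie 0 X = 0.
Proof. by apply: vfield_eq => h; rewrite lieE vf0 subrr. Qed.

Lemma liev0 X : lie X 0 = 0.
Proof. by rewrite lie_anti lie0v oppr0. Qed.

Lemma bivector_skew P a b : b (P a) = - a (P b) :> C.
Proof. by have /asboolP[_] := bivectorP P; apply. Qed.

Lemma bivectorD P a b : P (a + b) = P a + P b.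
Proof.
by have /asboolP[PL _] := bivectorP P; have := PL 1 a b; rewrite !scale1r.
Qed.

Lemma bivectorN P a : P (- a) = - P a.
Proof.
apply: (addrI (P a)); rewrite -bivectorD !subrr.
by apply: (addrI (P 0)); rewrite -bivectorD !addr0.
Qed.

Lemma schoutenD P Q a b c :
  schouten (P + Q) (P + Q) a b c =
    schouten P P a b c + schouten P Q a b c *+ 2 + schouten Q Q a b c.
Proof.
have lfD X Y (d : O1) Z :
    lieform (X + Y) d Z = lieform X d Z + lieform Y d Z :> C.
  have -> : X + Y = X - (- Y) by rewrite opprK.
  rewrite lieformBl; congr (_ + _); rewrite !lieformE.
  have -> : lie (- Y) Z = - lie Y Z.
    by apply: vfield_eq => h; rewrite !(vfNE, lieE) vfN; ring.
  by rewrite formN vfNE; ring.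
have E d : (P + Q) d = P d + Q d by [].
rewrite /schouten /schouten_term !E !lfD !formD; ring.
Qed.

(** The Koszul bracket of 1-forms attached to P. *)
Definition koszul P a b : O1 :=
  lieform (P a) b - lieform (P b) a + dform (a (P b)).

(** By skewness of P, pairing c with P (koszul P a b) turns the six terms of the
    cyclic sum into the value of a single vector field, so that P is Poisson
    as soon as it intertwines the two brackets. *)
Lemma schouten_koszul P a b c :
  schouten P P a b c = (c (lie (P a) (P b) - P (koszul P a b)) : C) *+ 2.
Proof.
rewrite formB (bivector_skew P (koszul P a b) c) /koszul.
rewrite !(formDE, formNE) /schouten /schouten_term !lieformE /=.
rewrite (bivector_skew P c a) vfN.
rewrite (lie_anti (P b) (P a)) (lie_anti (P c) (P b)) !formN.
ring.
Qed.

(** Since [P, X /\ Y] is, up to sign, (L_X P) /\ Y - (L_Y P) /\ X, it vanishes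
    as soon as P is invariant under X and Y; the hypotheses say L_X P = 0 and
    L_Y P = 0. *)
Lemma schouten_invariant_wedge P X Y :
  (forall a, lie X (P a) = P (lieform X a)) ->
  (forall a, lie Y (P a) = P (lieform Y a)) ->
  forall a b c, schouten P (wedge X Y) a b c = 0.
Proof.
move=> PX PY.
(* Both kinds of terms of the bracket become values of L_Z a (P b), which
   then cancel in the cyclic sum. *)
have A Z (PZ : forall a, lie Z (P a) = P (lieform Z a)) a b :
    lieform (P a) b Z = (P a (b Z : C) : C) - lieform Z a (P b).
  by rewrite lieformE lie_anti PZ formN bivector_skew opprK.
have B Z W (f g : C) d (c : O1) :
    lieform (f *: Z - g *: W) d (P c) =
      (f * lieform Z d (P c) + (P c f : C) * d Z
      - (g * lieform W d (P c) + (P c g : C) * d W)) :> C.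
  rewrite lieformBl -[P c]scale1r !lieform_scale !scale1r; ring.
move=> a b c; rewrite /schouten /schouten_term !wedgeE !B !formB !formZ.
rewrite !(A X PX) !(A Y PY); ring.
Qed.

Lemma schouten_wedge_commuting X Y a b c :
  lie X Y = 0 -> schouten (wedge X Y) (wedge X Y) a b c = 0.
Proof.
move=> XY; rewrite schouten_wedge (lie_anti Y X) XY oppr0 !lie_id /wedge3.
rewrite !form0; ring.
Qed.

End BivectorCalculus.

(** * The Dorfman bracket *)

Section Dorfman.
Context {R : realType} {n : nat} {M : smooth_manifold R n}.
Local Notation C := (smoothfun M).
Local Notation TT := (gtangent M).
Local Notation half := (scst M 2^-1).
Implicit Types (f g h : C) (u v w : TT).

(** Twice the metric, which removes the factors 1/2 from all computations. *)
Definition pairing u v : C := v.2 u.1 + u.2 v.1.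

(** The non-skew version of the Courant bracket: unlike the latter it is a
    derivation of functions (dorfmanZr) and of the metric (dorfman_invariant)
    in its second argument, and on isotropic subbundles the two agree. *)
Definition dorfman u v : TT :=
  (lie u.1 v.1, lieform u.1 v.2 - lieform v.1 u.2 + dform (u.2 v.1)).

Lemma TT_eq u v : u.1 = v.1 -> u.2 = v.2 -> u = v.
Proof. by case: u v => [? ?] [? ?] /= -> ->. Qed.

Lemma fstDE u v : (u + v).1 = u.1 + v.1. Proof. by []. Qed.
Lemma sndDE u v : (u + v).2 = u.2 + v.2. Proof. by []. Qed.
Lemma fstNE u : (- u).1 = - u.1. Proof. by []. Qed.
Lemma sndNE u : (- u).2 = - u.2. Proof. by []. Qed.
Lemma fstZE f u : (f *: u).1 = f *: u.1. Proof. by []. Qed.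
Lemma sndZE f u : (f *: u).2 = f *: u.2. Proof. by []. Qed.
Definition gtE := (fstDE, sndDE, fstNE, sndNE, fstZE, sndZE).

Lemma dorfman1 u v : (dorfman u v).1 = lie u.1 v.1. Proof. by []. Qed.
Lemma dorfman2 u v :
  (dorfman u v).2 = lieform u.1 v.2 - lieform v.1 u.2 + dform (u.2 v.1).
Proof. by []. Qed.
Lemma dformE f (X : vfield M) : dform f X = X f. Proof. by []. Qed.

Lemma pairingC u v : pairing u v = pairing v u.
Proof. by rewrite /pairing addrC. Qed.

Lemma pairingDr u v w : pairing u (v + w) = pairing u v + pairing u w.
Proof. by rewrite /pairing !gtE formD formDE; ring. Qed.

Lemma pairingZr f u v : pairing u (f *: v) = f * pairing u v.
Proof. by rewrite /pairing !gtE formZ formZE; ring. Qed.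

Lemma pairingNr u v : pairing u (- v) = - pairing u v.
Proof. by rewrite -scaleN1r pairingZr mulN1r. Qed.

Lemma pairing0r u : pairing u 0 = 0.
Proof. by rewrite -(scale0r u) pairingZr mul0r. Qed.

Lemma half_double f : half * f + half * f = f.
Proof.
rewrite -mulrDl -[RHS]mul1r; congr (_ * _); apply/val_inj/funext => x.
by rewrite -[LHS]/(2^-1 + 2^-1 : R) -[RHS]/(1 : R); field.
Qed.

Lemma dorfman_courant u v :
  dorfman u v = courant u v + (0, dform (half * pairing u v)).
Proof.
apply: TT_eq; first by rewrite gtE /= addr0.
apply: oneform_eq => Z; rewrite gtE dorfman2 /courant.
rewrite !(formDE, formNE, formZE, dformE) /pairing vfZ !vfD vfN.
set p := Z (u.2 v.1 : C); rewrite -[X in _ + X = _]half_double -/p; ring.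
Qed.

Lemma courant_anti u v : courant v u = - courant u v.
Proof.
apply: TT_eq; rewrite gtE /courant; first exact: lie_anti.
apply: oneform_eq => Z; rewrite !(formDE, formNE, formZE, dformE) !(vfD, vfN).
ring.
Qed.

Lemma dform0 : dform (0 : C) = 0.
Proof. by apply: oneform_eq => Z; rewrite dformE vf0. Qed.

Lemma lieform0l (b : oneform M) : lieform 0 b = 0.
Proof. by apply: oneform_eq => Z; rewrite lieformE lie0v form0 subr0. Qed.

Lemma dorfman_isotropic {u v} : pairing u v = 0 -> dorfman u v = courant u v.
Proof. by move=> uv; rewrite dorfman_courant uv mulr0 dform0 addr0. Qed.

Lemma dorfman_skew u v :
  dorfman v u = - dorfman u v + (0, dform (pairing u v)).
Proof.
apply: TT_eq; first by rewrite !gtE !dorfman1 addr0 lie_anti.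
apply: oneform_eq => Z; rewrite !gtE !dorfman2.
rewrite !(formDE, formNE, dformE) /pairing vfD; ring.
Qed.

Lemma dorfmanDr u v w : dorfman u (v + w) = dorfman u v + dorfman u w.
Proof.
apply: TT_eq; rewrite !gtE !(dorfman1, dorfman2) !gtE.
  by apply: vfield_eq => h; rewrite !(vfDE, lieE) vfD; ring.
have lDl (X Y Z : vfield M) : lie (X + Y) Z = lie X Z + lie Y Z.
  by apply: vfield_eq => h; rewrite !(vfDE, lieE) !vfD; ring.
apply: oneform_eq => Z; rewrite !(formDE, formNE, dformE).
by rewrite !lieformE lDl !(formDE, formD, vfDE, vfD); ring.
Qed.

Lemma dorfmanZr f u v :
  dorfman u (f *: v) = f *: dorfman u v + (u.1 f : C) *: v.
Proof.
apply: TT_eq; rewrite !gtE !(dorfman1, dorfman2) !gtE.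
  by apply: vfield_eq => h; rewrite !(vfDE, vfZE, lieE) !vfM; ring.
have lZl (X Z : vfield M) (b : oneform M) :
    lieform (f *: X) b Z = f * lieform X b Z + (Z f : C) * b X :> C.
  by rewrite -[Z in LHS]scale1r lieform_scale; ring.
apply: oneform_eq => Z; rewrite !(formDE, formNE, formZE, dformE) lZl.
by rewrite !lieformE !(formZE, formZ, vfM); ring.
Qed.

Lemma courant0v u : courant 0 u = 0.
Proof.
have p0 : pairing 0 u = 0 by rewrite pairingC pairing0r.
rewrite -dorfman_isotropic // dorfman_skew pairingC p0 dform0 addr0.
by have := dorfmanZr 0 u 0; rewrite !scale0r scaler0 addr0 => ->; rewrite oppr0.
Qed.

Lemma dorfman_invariant u v w :
  u.1 (pairing v w) = pairing (dorfman u v) w + pairing v (dorfman u w) :> C.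
Proof.
rewrite /pairing !(dorfman1, dorfman2) !(formDE, formNE, dformE, lieformE) vfD.
rewrite (lie_anti w.1 v.1) formN; ring.
Qed.

End Dorfman.

(** * Brackets on strong generalized contact structures *)

Section StrongStructures.
Context {R : realType} {n : nat} {M : smooth_manifold R n}.
Local Notation C := (smoothfun M).
Local Notation TT := (gtangent M).
Implicit Types (f g h : C) (u v w : TT) (G : gen_almost_contact M).

Lemma PhiD G u v : G (u + v) = G u + G v. Proof. exact: linearD. Qed.
Lemma Phi0 G : G 0 = 0. Proof. exact: linear0. Qed.
Lemma PhiN G u : G (- u) = - G u. Proof. exact: linearN. Qed.
Lemma PhiZ G f u : G (f *: u) = f *: G u. Proof. exact: linearZ. Qed.

Lemma Phi_sq G u :
  G (G u) = - u + pairing (gEm G) u *: gEp G + pairing (gEp G) u *: gEm G.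
Proof. by rewrite gPhi_sq /tensor !metric2. Qed.

Lemma Phi_skew G u v : pairing (G u) v = - pairing u (G v).
Proof.
have [Phis adj skew] := gPhi_skew G.
have PhisE w : Phis w = - G w by apply/eqP; rewrite -addr_eq0 addrC skew.
by have := metric2 (G u) v; rewrite adj metric2 PhisE -/(pairing _ _)
  -/(pairing _ _) pairingNr => <-.
Qed.

Lemma metric_pairing u v : metric u v = 0 -> pairing u v = 0.
Proof. by move=> m0; rewrite -[LHS]metric2 m0 mul0rn. Qed.

Lemma pairing_pp G : pairing (gEp G) (gEp G) = 0.
Proof. exact: metric_pairing (gEp_isotropic G). Qed.

Lemma pairing_mm G : pairing (gEm G) (gEm G) = 0.
Proof. exact: metric_pairing (gEm_isotropic G). Qed.

Lemma pairing_pm G : pairing (gEp G) (gEm G) = 1.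
Proof. by rewrite -[LHS]metric2 gEpm_pairing. Qed.

Lemma pairing_mp G : pairing (gEm G) (gEp G) = 1.
Proof. by rewrite pairingC pairing_pm. Qed.

Lemma Phi_sq_swap G u :
  G (G u) = - u + tensor (gEm G) (gEp G) u + tensor (gEp G) (gEm G) u.
Proof. by rewrite gPhi_sq addrAC. Qed.

Lemma metric_swap G : metric (gEm G) (gEp G) *+ 2 = 1.
Proof. by rewrite metric2; exact: pairing_mp. Qed.

(** Exchanging E+ and E- turns every statement about E+ into the one about
    E-. *)
Definition swap G : gen_almost_contact M :=
  @GenAlmostContact R n M G (gEm G) (gEp G) (gPhi_skew G) (Phi_sq_swap G)
    (gEm_isotropic G) (gEp_isotropic G) (metric_swap G).

Lemma smooth_sq_eq0 f : f * f = 0 -> f = 0.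
Proof.
move=> ff; apply/val_inj/funext => x.
have /eqP : f x * f x = 0.
  by have := congr1 (fun g : C => (g : M -> R) x) ff.
by rewrite mulf_eq0 orbb => /eqP.
Qed.

Lemma pairing_self_Phi G u : pairing u (G u) = 0.
Proof.
have := Phi_skew G u u; rewrite pairingC => /eqP; rewrite -addr_eq0 => /eqP h.
by rewrite -[LHS]half_double -mulrDr h mulr0.
Qed.

(** From Phi^2 E+ = 0 and the formula for Phi^2 applied to Phi E+ it follows
    that Phi E+ = l E+ for a function l; then l^2 E+ = 0 forces l = 0, because
    smooth functions have no nilpotents. *)
Lemma Phi_Ep G : G (gEp G) = 0.
Proof.
set l := pairing (gEm G) (G (gEp G)).
have sq0 : G (G (gEp G)) = 0.
  by rewrite Phi_sq pairing_mp pairing_pp scale1r scale0r addr0 addNr.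
have lE : G (gEp G) = l *: gEp G.
  have := Phi_sq G (G (gEp G)); rewrite sq0 Phi0 -/l pairing_self_Phi.
  by rewrite scale0r addr0 => /esym/eqP; rewrite addrC subr_eq0 => /eqP.
have : l * l = 0.
  have := sq0; rewrite {1}lE PhiZ lE scalerA => /(congr1 (pairing (gEm G))).
  by rewrite pairingZr pairing_mp pairing0r mulr1.
by move/smooth_sq_eq0 => l0; rewrite lE l0 scale0r.
Qed.

Lemma Phi_Em G : G (gEm G) = 0.
Proof. exact: Phi_Ep (swap G). Qed.

Lemma pairing_Ep_Phi G u : pairing (gEp G) (G u) = 0.
Proof. by rewrite pairingC Phi_skew Phi_Ep pairing0r oppr0. Qed.

Lemma pairing_Em_Phi G u : pairing (gEm G) (G u) = 0.
Proof. exact: pairing_Ep_Phi (swap G) u. Qed.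

(** The projection onto the orthogonal of E+ and E- (see projE). *)
Definition proj G u : TT := - G (G u).

Lemma projE G u :
  proj G u = u - pairing (gEm G) u *: gEp G - pairing (gEp G) u *: gEm G.
Proof. by rewrite /proj Phi_sq !opprD opprK. Qed.

Lemma Phi_proj G u : G (proj G u) = G u.
Proof.
by rewrite projE !(PhiD, PhiN, PhiZ) Phi_Ep Phi_Em !scaler0 !subr0.
Qed.

Lemma E10P G (w : TT * TT) : E10 G w <-> G w.2 = w.1 /\ G w.1 = - w.2.
Proof.
case: w => [w1 w2]; rewrite /E10 /phiC /cscale /= !scale0r !scale1r !add0r.
by split=> [[-> ->]|[-> ->]].
Qed.

(** This is i (p(u) - i Phi u), where p(u) = proj G u; multiplying by i avoids
    signs later. *)
Lemma E10_proj G u : E10 G (G u, proj G u).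
Proof. by apply/E10P; rewrite /= Phi_proj opprK. Qed.

Lemma E10_orth_Em {G} {w : TT * TT} : E10 G w ->
  pairing (gEm G) w.1 = 0 /\ pairing (gEm G) w.2 = 0.
Proof.
move=> /E10P[w1 w2]; rewrite -w1 pairing_Em_Phi; split=> //.
by apply: oppr_inj; rewrite -pairingNr -w2 pairing_Em_Phi oppr0.
Qed.

Lemma Lminus_orth_Em {G} {w : TT * TT} : Lminus G w ->
  pairing (gEm G) w.1 = 0 /\ pairing (gEm G) w.2 = 0.
Proof.
move=> [a [z /E10_orth_Em[z1 z2] ->]] /=.
by rewrite !(pairingDr, pairingNr, pairingZr) pairing_mm pairing0r z1 z2;
  split; ring.
Qed.

(** Pairing with E- reads off the component along E+. *)
Lemma Lplus_E10 {G} {w : TT * TT} : Lplus G w ->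
  pairing (gEm G) w.1 = 0 -> pairing (gEm G) w.2 = 0 -> E10 G w.
Proof.
move=> [[a1 a2] [z Ez ->]] /=; have [z1 z2] := E10_orth_Em Ez.
rewrite !(pairingDr, pairingNr, pairingZr) pairing_mp pairing0r z1 z2.
rewrite !mulr0 !mulr1 !addr0 subr0 => -> ; rewrite add0r => ->.
by rewrite /cscale /creal /= !scale0r subr0 addr0 add0r; case: z Ez {z1 z2}.
Qed.

(** A bracket of two sections of E^(1,0) lies in L-, so it is orthogonal to E-;
    being also in L+, it has no component along E+. *)
Lemma E10_closed {G} : strong_gen_contact G -> courant_closed (E10 G).
Proof.
move=> [cp cm] w z Ew Ez.
have sub E (v : TT * TT) : E10 G v -> spanE10 G E v.
  move=> Ev; exists 0, v => //.
  by rewrite /cscale /= !scale0r subr0 addr0 add0r; case: v Ev.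
have [m1 m2] := Lminus_orth_Em (cm _ _ (sub _ _ Ew) (sub _ _ Ez)).
by apply: Lplus_E10 m1 m2; apply: cp; apply: sub.
Qed.

Lemma dorfman_Epm {G} : courant (gEp G) (gEm G) = 0 ->
  dorfman (gEp G) (gEm G) = 0.
Proof.
move=> br; rewrite dorfman_courant br add0r pairing_pm mulr1; congr pair.
by apply: oneform_eq => Z; rewrite dformE -[scst M _]mulr1 vfZ vf1 mulr0.
Qed.

Lemma dorfman_Epp G : dorfman (gEp G) (gEp G) = 0.
Proof.
rewrite dorfman_isotropic ?pairing_pp // /courant lie_id !subrr.
congr pair; apply: oneform_eq => Z.
by rewrite formDE formNE formZE dformE vf0 mulr0 oppr0 addr0.
Qed.

Lemma courant_swap {G} :
  courant (gEp G) (gEm G) = 0 -> courant (gEm G) (gEp G) = 0.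
Proof.
by move=> br; rewrite courant_anti br oppr0.
Qed.

Lemma strong_swap {G} : strong_gen_contact G -> strong_gen_contact (swap G).
Proof. by case. Qed.

Lemma pairing_Ep_proj G u : pairing (gEp G) (proj G u) = 0.
Proof. by rewrite /proj pairingNr pairing_Ep_Phi oppr0. Qed.

Lemma pairing_Em_proj G u : pairing (gEm G) (proj G u) = 0.
Proof. by rewrite /proj pairingNr pairing_Em_Phi oppr0. Qed.

(** The bracket of E+ with a section of E^(1,0) is again in E^(1,0): it is in
    L+, and orthogonal to E- because D_(E+) preserves the metric and
    annihilates E-.  For the section Phi u + i p(u), the imaginary part of the
    eigenvalue equation of the bracket is
    D_(E+) Phi u = Phi D_(E+) p(u), and the components of u along E+ and E-
    contribute to D_(E+) u only multiples of E+ and E-, which Phi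
    annihilates. *)
Lemma dorfman_Ep_Phi {G} : strong_gen_contact G ->
  courant (gEp G) (gEm G) = 0 ->
  forall u, dorfman (gEp G) (G u) = G (dorfman (gEp G) u).
Proof.
move=> [cp _] br u; pose E := gEp G.
have Em0 v : pairing (gEm G) v = 0 -> pairing (gEm G) (dorfman E v) = 0.
  move=> v0; have := dorfman_invariant E (gEm G) v.
  by rewrite v0 vf0 dorfman_Epm // pairingC pairing0r add0r => <-.
have Ew : E10 G (ccourant (creal E) (G u, proj G u)).
  apply: Lplus_E10.
  - apply: cp.
      exists (1, 0), 0; first by apply/E10P; rewrite Phi0 oppr0.
      by rewrite /cscale /creal /= !scale1r !scale0r subr0 !addr0.
    exists 0, (G u, proj G u); first exact: E10_proj.
    by rewrite /cscale /= !scale0r subr0 addr0 add0r.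
  - rewrite /ccourant /= courant0v subr0 -dorfman_isotropic ?pairing_Ep_Phi //.
    exact/Em0/pairing_Em_Phi.
  - rewrite /ccourant /= courant0v addr0 -dorfman_isotropic ?pairing_Ep_proj //.
    exact/Em0/pairing_Em_proj.
have /E10P[] := Ew; rewrite /ccourant /= !courant0v subr0 addr0.
rewrite -(dorfman_isotropic (pairing_Ep_proj G u)).
rewrite -(dorfman_isotropic (pairing_Ep_Phi G u)) => <- _.
rewrite projE -!scaleNr !(dorfmanDr, dorfmanZr) dorfman_Epp dorfman_Epm //.
by rewrite !(PhiD, PhiZ) Phi_Ep Phi_Em Phi0 !scaler0 !addr0.
Qed.

Lemma dorfman_Em_Phi {G} : strong_gen_contact G ->
  courant (gEp G) (gEm G) = 0 ->
  forall u, dorfman (gEm G) (G u) = G (dorfman (gEm G) u).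
Proof.
move=> sG br; exact: dorfman_Ep_Phi (strong_swap sG) (courant_swap br).
Qed.

Lemma pairing_proj_Phi G u v : pairing (proj G u) (G v) = pairing u (G v).
Proof. by rewrite pairingC Phi_skew Phi_proj -Phi_skew pairingC. Qed.

(** The imaginary part of the eigenvalue equation for the bracket of
    Phi u + i p(u) and Phi v + i p(v), where p = proj G.  The Courant bracket
    can be replaced by the Dorfman bracket because E^(1,0) is isotropic for the
    complexified metric: the terms d<., .> cancel in both components of the
    bracket. *)
Lemma dorfman_E10 {G} : strong_gen_contact G -> forall u v,
  dorfman (G u) (G v) - dorfman (proj G u) (proj G v) =
    G (dorfman (G u) (proj G v) + dorfman (proj G u) (G v)).
Proof.
move=> sG u v.
have /E10P[] := E10_closed sG _ _ (E10_proj G u) (E10_proj G v).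
rewrite /ccourant /= => hre _.
rewrite !dorfman_courant.
have iso1 : pairing (G u) (G v) = pairing (proj G u) (proj G v).
  by rewrite {2}/proj pairingNr pairing_proj_Phi Phi_skew.
have iso2 : pairing (G u) (proj G v) = - pairing (proj G u) (G v).
  by rewrite pairingC !pairing_proj_Phi -Phi_skew pairingC.
have dN f : (0, dform (- f)) + (0, dform f) = 0 :> TT.
  apply: TT_eq; rewrite gtE; first exact: addr0.
  by apply: oneform_eq => Z; rewrite formDE !dformE vfN addNr.
rewrite iso1 iso2 mulrN opprD addrACA subrr addr0 addrACA dN addr0.
by rewrite hre.
Qed.

(** Replacing v by its projection removes multiples of E+ and E-; for these,
    Phi D_(Phi u) E = - Phi D_E (Phi u) = - Phi^2 (D_E u) when E is E+ or E-,
    since Phi u is orthogonal to E and D_E commutes with Phi. *)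
Lemma Phi_dorfman_proj {G} : strong_gen_contact G ->
  courant (gEp G) (gEm G) = 0 -> forall u v,
  G (dorfman (G u) (proj G v)) = G (dorfman (G u) v)
    - pairing (gEm G) v *: proj G (dorfman (gEp G) u)
    - pairing (gEp G) v *: proj G (dorfman (gEm G) u).
Proof.
move=> sG br u v.
have key E : pairing E (G u) = 0 -> dorfman E (G u) = G (dorfman E u) ->
    G (dorfman (G u) E) = proj G (dorfman E u).
  move=> E0 EP; rewrite dorfman_skew E0 EP PhiD PhiN.
  by rewrite dform0 Phi0 addr0.
rewrite projE -!scaleNr !(dorfmanDr, dorfmanZr) !(PhiD, PhiZ).
rewrite Phi_Ep Phi_Em !scaler0 !addr0 !scaleNr.
rewrite (key _ (pairing_Ep_Phi G u) (dorfman_Ep_Phi sG br u)).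
by rewrite (key _ (pairing_Em_Phi G u) (dorfman_Em_Phi sG br u)).
Qed.

End StrongStructures.

(** * The Poisson property *)

Section Conclusion.
Context {R : realType} {n : nat} {M : smooth_manifold R n}.
Context {G : gen_almost_contact M}.
Context (sG : strong_gen_contact G) (br : courant (gEp G) (gEm G) = 0).
Local Notation C := (smoothfun M).
Local Notation ep := (gEp G).1.
Local Notation em := (gEm G).1.
Implicit Types (a b : oneform M).

Lemma lie_epm : lie ep em = 0.
Proof. by have := congr1 fst br. Qed.

Lemma dorfman_form (u : gtangent M) a : dorfman u (0, a) = (0, lieform u.1 a).
Proof.
rewrite -[LHS]/(lie u.1 0, lieform u.1 a - lieform 0 u.2 + dform (u.2 0)).
by rewrite liev0 lieform0l form0 dform0 subr0 addr0.
Qed.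

Lemma lie_ep_pi0 a : lie ep (pi0 G a) = pi0 G (lieform ep a).
Proof.
have := dorfman_Ep_Phi sG br (0, a).
by rewrite dorfman_form => /(congr1 fst).
Qed.

Lemma lie_em_pi0 a : lie em (pi0 G a) = pi0 G (lieform em a).
Proof.
have := dorfman_Em_Phi sG br (0, a).
by rewrite dorfman_form => /(congr1 fst).
Qed.

Lemma pairing_form (u : gtangent M) a : pairing u (0, a) = a u.1.
Proof. by rewrite /pairing /= form0 addr0. Qed.

Lemma proj_form1 a :
  (proj G (0, a)).1 = - ((a em : C) *: ep) - (a ep : C) *: em.
Proof. by rewrite projE !gtE !pairing_form /= add0r. Qed.

Lemma lieform_ep a :
  lieform ep a ep = ep (a ep : C) /\ lieform ep a em = ep (a em : C).
Proof. by rewrite !lieformE lie_id lie_epm form0 !subr0. Qed.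

Lemma lieform_em a :
  lieform em a ep = em (a ep : C) /\ lieform em a em = em (a em : C).
Proof.
have me : lie em ep = 0 by rewrite lie_anti lie_epm oppr0.
by rewrite !lieformE lie_id me form0 !subr0.
Qed.

(** The vector component of dorfman_E10 on two 1-forms.  With
      p(a) = a - a(e-) E+ - a(e+) E-,
    the vector component of D_(p(a)) p(b) is the bracket of two combinations
    of e+ and e-; since these commute, only derivatives of the coefficients
    remain, and they match the correction terms of Phi_dorfman_proj. *)
Lemma pi0_koszul a b :
  lie (pi0 G a) (pi0 G b) = pi0 G (koszul (pi0 G) a b).
Proof.
pose u : gtangent M := (0, a); pose v : gtangent M := (0, b).
have uv : dorfman (proj G u) (G v) =
    - dorfman (G v) (proj G u) + (0, dform (a (pi0 G b))).
  rewrite dorfman_skew; congr (_ + (0, dform _)).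
  by rewrite pairingC pairing_proj_Phi pairingC pairing_form.
have := congr1 fst (dorfman_E10 sG u v).
rewrite uv !(PhiD, PhiN) !(Phi_dorfman_proj sG br) !pairing_form !dorfman_form.
rewrite /u /v !(proj_form1, fstDE, fstNE, fstZE) !dorfman1 !proj_form1.
rewrite !(lieform_ep _).1 !(lieform_ep _).2.
rewrite !(lieform_em _).1 !(lieform_em _).2.
have pE c : (G (0, c)).1 = pi0 G c by [].
rewrite /koszul !(pE, bivectorD, bivectorN) => E; apply: vfield_eq => h.
have := congr1 (fun X : vfield M => X h : C) E.
have epm : em (ep h : C) = ep (em h : C).
  have := congr1 (fun X : vfield M => X h : C) lie_epm.
  by rewrite lieE => /subr0_eq.
rewrite !(vfDE, vfNE, vfZE) => /(canRL (subrK _)) ->.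
rewrite lieE !(vfDE, vfNE, vfZE) !(vfD, vfN) !vfM epm; ring.
Qed.

Lemma pi0_poisson : poisson (pi0 G).
Proof.
by move=> a b c; rewrite schouten_koszul pi0_koszul subrr form0 mul0rn.
Qed.

End Conclusion.

Theorem lemma3p1 (R : realType) (n : nat) (M : smooth_manifold R n)
    (G : gen_almost_contact M) (n_odd : odd n)
    (G_strong : strong_gen_contact G)
    (brE : courant (gEp G) (gEm G) = 0) :
  poisson (pi_M G).
Proof.
move=> a b c; rewrite /pi_M schoutenD pi0_poisson //.
rewrite schouten_invariant_wedge; last 2 first.
- exact: lie_ep_pi0.
- exact: lie_em_pi0.
by rewrite schouten_wedge_commuting ?lie_epm // mul0rn !addr0.
Qed.
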